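(* In the setting of the context, let $J:K\times K\to\mathbb R$ be a measurable kernel with $J\in L^2(K\times K,\nu\times\nu)$ (or, more generally, satisfying the Schur-type bounds $\operatorname{ess\,sup}_{x}\int_K|J(x,y)|\,d\nu(y)<\infty$ and $\operatorname{ess\,sup}_{y}\int_K|J(x,y)|\,d\nu(x)<\infty$). Let $J^\Phi(\xi,\eta)=J(\Phi(\xi),\Phi(\eta))$ for $(\xi,\eta)\in Q_0\times Q_0$ and $J^\Phi(\xi,\eta)=0$ otherwise. Let $\mathcal L_K$ be the operator on $L^2(K,\nu)$ $$(\mathcal L_Ku)(x)=\int_KJ(x,y)\big(u(y)-u(x)\big)\,d\nu(y),$$ and let $\mathcal L_Q$ be the operator on $L^2(Q,\lambda)$ $$(\mathcal L_Qv)(\xi)=\int_QJ^\Phi(\xi,\eta)\big(v(\eta)-v(\xi)\big)\,d\lambda(\eta).$$ Then $T\,\mathcal L_K\,T^{-1}=\mathcal L_Q$. Consequently, $u$ solves $\partial_tu=\mathcal L_Ku$ on $K$ if and only if $v:=Tu$ solves $\partial_tv=\mathcal L_Qv$ on $Q$.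
   Context: Self-similar set. Let $f_1,\dots,f_k:\mathbb R^d\to\mathbb R^d$ be similitudes, $|f_i(x)-f_i(y)|=r_i|x-y|$ with $0<r_i<1$, and let $K$ be their attractor, the unique nonempty compact set with $K=\bigcup_{i=1}^kf_i(K)$. Let $\Sigma=\{1,\dots,k\}^{\mathbb N}$; for a finite word $w=w_1\cdots w_n$ put $f_w=f_{w_1}\circ\cdots\circ f_{w_n}$, $K_w=f_w(K)$. The natural projection $\pi_K:\Sigma\to K$ sends $(w_1w_2\dots)$ to the unique point of $\bigcap_{n\ge1}K_{w_1\cdots w_n}$. Let $\mu$ be the uniform Bernoulli measure on $\Sigma$ (each cylinder of length $n$ has measure $k^{-n}$) and $\nu=(\pi_K)_*\mu$. Standing assumption: the set of $w\in\Sigma$ such that $\pi_K^{-1}(\pi_K(w))$ has more than one element is $\mu$-null. Reference interval. Let $Q=[0,1]$, $g_i(x)=\frac xk+\frac{i-1}k$ for $i=1,\dots,k$, and let $\pi_Q:\Sigma\to Q$ be the natural projection of this IFS; $\lambda=(\pi_Q)_*\mu$ is Lebesgue measure on $[0,1]$. There are full-measure sets $Q_0\subset Q$, $K_0\subset K$ and a measure-preserving bijection $\Phi:Q_0\to K_0$ with $\Phi\circ\pi_Q=\pi_K$ $\mu$-a.e. The operator $T:L^2(K,\nu)\to L^2(Q,\lambda)$, $Tf=f\circ\Phi$ (a.e.), is a surjective linear isometry, with $T^{-1}g=g\circ\Phi^{-1}$ (a.e.). Convention. $\mathcal L_K$ and $\mathcal L_Q$ are taken with their natural domains, i.e. all $u\in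 L^2(K,\nu)$ (resp. $v\in L^2(Q,\lambda)$) for which the defining expression belongs to $L^2$; under the Schur-type bounds these are the whole spaces. Solutions of the two evolution equations are understood in the same sense ($L^2$-valued functions of time) on both sides. *)

(* Defs.v *)
From HB Require Import structures.
From mathcomp Require Import all_boot all_order all_algebra.
From mathcomp Require Import all_classical all_reals all_analysis.
From mathcomp Require Import measurable_realfun ess_sup_inf.

Set Implicit Arguments.
Unset Strict Implicit.
Unset Printing Implicit Defensive.
Import Order.TTheory GRing.Theory Num.Theory.
Import numFieldNormedType.Exports.

Local Open Scope classical_set_scope.
Local Open Scope ring_scope.

(* The library norm on 'rV[R]_d is the sup norm, hence the explicit
   Euclidean norm. *)
Definition enorm (R : realType) (d : nat) (x : 'rV[R]_d) : R :=
  Num.sqrt (\sum_(i < d) x ord0 i ^+ 2).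

Definition is_similitude (R : realType) (d : nat) (r : R)
    (f : 'rV[R]_d -> 'rV[R]_d) : Prop :=
  [/\ 0 < r, r < 1 & forall x y, enorm (f x - f y) = r * enorm (x - y)].

Definition is_attractor (X : topologicalType) (I : Type) (f : I -> X -> X)
    (K : set X) : Prop :=
  [/\ K !=set0, compact K & K = \bigcup_i (f i @` K)].

(* f_w = f_{w_1} \o ... \o f_{w_n} *)
Definition word_map (X I : Type) (f : I -> X -> X) (w : seq I) : X -> X :=
  foldr (fun i g => f i \o g) id w.

Definition cell (X I : Type) (f : I -> X -> X) (K : set X) (w : seq I) : set X :=
  word_map f w @` K.

(* [mkseq w n] is the prefix w_1 ... w_n; the chosen point is only meaningful
   when the cells shrink to a single point. *)
Definition natural_projection (X : pointedType) (I : Type) (f : I -> X -> X)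
    (K : set X) (w : nat -> I) : X :=
  get (\bigcap_(n in [set n | (0 < n)%N]) cell f K (mkseq w n)).

Definition cylinder (I : Type) (s : seq I) : set (nat -> I) :=
  [set w | mkseq w (size s) = s].

(* The bound on the alphabet size is only there because measurable types of the
   library come with a point. *)
Definition words (k : nat) (k1 : (1 < k)%N) : Type := nat -> 'I_k.

HB.instance Definition _ (k : nat) (k1 : (1 < k)%N) :=
  Choice.copy (words k1) (nat -> 'I_k).
HB.instance Definition _ (k : nat) (k1 : (1 < k)%N) :=
  isPointed.Build (words k1) (fun=> Ordinal (ltnW k1)).

Notation symbolic k1 :=
  (@g_sigma_algebraType (words k1) (range (@cylinder (ordinal _)))).

Definition is_uniform_bernoulli (R : realType) (k : nat) (k1 : (1 < k)%N)
    (mu : probability (symbolic k1) R) : Prop :=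
  forall s : seq 'I_k, mu (cylinder s) = (k%:R ^- size s)%:E.

Notation borel_rV R d := (@g_sigma_algebraType 'rV[R]_d (@open 'rV[R]_d)).

Definition interval_map (R : realType) (k : nat) (i : 'I_k) (x : R) : R :=
  x / k%:R + i%:R / k%:R.

Definition Qint (R : realType) : set R := `[0, 1].
Arguments Qint R : clear implicits.

Lemma measurable_Qint (R : realType) :
  measurable (Qint R : set (measurableTypeR R)).
Proof. exact: measurable_itv. Qed.

Definition lebesgue01 (R : realType) :
    {measure set (measurableTypeR R) -> \bar R} :=
  mrestr lebesgue_measure (@measurable_Qint R).
Arguments lebesgue01 R : clear implicits.

(* [iso_fun] and [iso_inv] are only relevant on the full-measure sets
   [iso_dom] and [iso_cod], on which they are mutually inverse. *)
Record mod0_iso d1 d2 (X : measurableType d1) (Y : measurableType d2)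
    (R : realType) (mu : {measure set X -> \bar R})
    (nu : {measure set Y -> \bar R}) := Mod0Iso {
  iso_dom : set X ;
  iso_cod : set Y ;
  iso_fun :> X -> Y ;
  iso_inv : Y -> X ;
  measurable_iso_dom : measurable iso_dom ;
  measurable_iso_cod : measurable iso_cod ;
  iso_dom_full : mu (~` iso_dom) = 0%E ;
  iso_cod_full : nu (~` iso_cod) = 0%E ;
  iso_funS : forall x, iso_dom x -> iso_cod (iso_fun x) ;
  iso_invS : forall y, iso_cod y -> iso_dom (iso_inv y) ;
  iso_funK : forall x, iso_dom x -> iso_inv (iso_fun x) = x ;
  iso_invK : forall y, iso_cod y -> iso_fun (iso_inv y) = y ;
  measurable_iso_fun : measurable_fun iso_dom iso_fun ;
  measurable_iso_inv : measurable_fun iso_cod iso_inv ;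
  iso_preserving : forall B, measurable B ->
    mu (iso_dom `&` iso_fun @^-1` B) = nu B }.

Section mod0_iso_sym.
Context d1 d2 (X : measurableType d1) (Y : measurableType d2) (R : realType).
Variables (mu : {measure set X -> \bar R}) (nu : {measure set Y -> \bar R}).
Variable Phi : mod0_iso mu nu.

Lemma iso_preserving_inv A : measurable A ->
  nu (iso_cod Phi `&` iso_inv Phi @^-1` A) = mu A.
Proof.
move=> mA.
have mD := measurable_iso_dom Phi.
have mB : measurable (iso_cod Phi `&` iso_inv Phi @^-1` A).
  by apply: measurable_iso_inv => //; exact: measurable_iso_cod.
rewrite -(iso_preserving Phi mB).
rewrite (_ : _ `&` _ = A `&` iso_dom Phi); last first.
  apply/seteqP; split => [x /= [Dx [_]]|x /= [Ax Dx]].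
    by rewrite iso_funK.
  split=> //; split; first exact: iso_funS.
  by rewrite /= iso_funK.
rewrite -[in RHS](setIT A) -(setUv (iso_dom Phi)) setIUr measureU//.
- rewrite [X in (_ + X)%E](_ : _ = 0%E) ?adde0//.
  apply: (@subset_measure0 _ _ _ mu _ (~` iso_dom Phi)) => //.
  + exact/measurableI/measurableC.
  + exact: measurableC.
  + exact: iso_dom_full.
- exact: measurableI.
- exact/measurableI/measurableC.
- by rewrite -setIIr setICr setI0.
Qed.

Definition iso_sym : mod0_iso nu mu := {|
  iso_dom := iso_cod Phi ;
  iso_cod := iso_dom Phi ;
  iso_fun := iso_inv Phi ;
  iso_inv := iso_fun Phi ;
  measurable_iso_dom := @measurable_iso_cod _ _ _ _ _ _ _ Phi ;
  measurable_iso_cod := @measurable_iso_dom _ _ _ _ _ _ _ Phi ;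
  iso_dom_full := @iso_cod_full _ _ _ _ _ _ _ Phi ;
  iso_cod_full := @iso_dom_full _ _ _ _ _ _ _ Phi ;
  iso_funS := @iso_invS _ _ _ _ _ _ _ Phi ;
  iso_invS := @iso_funS _ _ _ _ _ _ _ Phi ;
  iso_funK := @iso_invK _ _ _ _ _ _ _ Phi ;
  iso_invK := @iso_funK _ _ _ _ _ _ _ Phi ;
  measurable_iso_fun := @measurable_iso_inv _ _ _ _ _ _ _ Phi ;
  measurable_iso_inv := @measurable_iso_fun _ _ _ _ _ _ _ Phi ;
  iso_preserving := iso_preserving_inv |}.

End mod0_iso_sym.


(* [LspaceType2] uses the copy [measurableTypeR R] of the measurable type [R]. *)
Lemma measurable_Lspace d (X : measurableType d) (R : realType)
    (mu : {measure set X -> \bar R}) (f : LspaceType2 mu) :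
  measurable_fun [set: X] (f : X -> R).
Proof. exact: (measurable_funP (repr (LebesgueSpace.sort f))). Qed.

Section koopman.
Context d1 d2 (X : measurableType d1) (Y : measurableType d2) (R : realType).
Variables (mu : {measure set X -> \bar R}) (nu : {measure set Y -> \bar R}).
Variable Phi : mod0_iso mu nu.

Definition iso_comp (f : Y -> R) : X -> R :=
  patch (fun=> 0) (iso_dom Phi) (f \o Phi).

Lemma measurable_iso_comp (f : Y -> R) :
  measurable_fun setT f -> measurable_fun setT (iso_comp f).
Proof.
move=> mf.
apply/(measurable_restrictT (f \o Phi) (measurable_iso_dom Phi)).
by apply: (measurable_comp measurableT) => //; exact: measurable_iso_fun.
Qed.

Let ext (x : X) : Y := patch (fun=> point) (iso_dom Phi) Phi x.

Let measurable_ext : measurable_fun setT ext.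
Proof.
apply/(measurable_restrictT Phi (measurable_iso_dom Phi)).
exact: measurable_iso_fun.
Qed.

Let mext := isMeasurableFun.Build _ _ _ _ _ measurable_ext.
Let ext_pack : {mfun _ >-> _} := HB.pack ext mext.

Let ext_pushforward A : measurable A -> pushforward mu ext_pack A = nu A.
Proof.
move=> mA; have mD := measurable_iso_dom Phi.
rewrite -(iso_preserving Phi mA) /pushforward.
have mE : measurable (ext @^-1` A) by rewrite -[_ @^-1` _]setTI; exact: measurable_ext.
rewrite -(setIT (_ @^-1` A)) -(setUv (iso_dom Phi)) setIUr measureU//.
- rewrite [X in (_ + X)%E](_ : _ = 0%E) ?adde0; last first.
    apply: (@subset_measure0 _ _ _ mu _ (~` iso_dom Phi)) => //.
    + exact/measurableI/measurableC.
    + exact: measurableC.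
    + exact: iso_dom_full.
  congr (mu _); apply/seteqP; split => x /=.
    by move=> [+ Dx]; rewrite /ext patchT ?inE.
  by move=> [Dx +]; rewrite /ext patchT ?inE.
- exact: measurableI.
- exact/measurableI/measurableC.
- by rewrite -setIIr setICr setI0.
Qed.

Lemma integral_iso_comp (h : Y -> \bar R) :
  measurable_fun [set: Y] h -> (forall y, (0 <= h y)%E) ->
  (\int[mu]_(x in iso_dom Phi) h (Phi x) = \int[nu]_y h y)%E.
Proof.
move=> mh h0; have mD := measurable_iso_dom Phi.
transitivity (\int[pushforward mu ext_pack]_y h y)%E; last first.
  by apply: eq_measure_integral => A mA _; exact: ext_pushforward.
rewrite ge0_integral_pushforward// preimage_setT.
rewrite (@ge0_negligible_integral _ _ _ mu setT (~` iso_dom Phi))//.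
- rewrite setTD setCK; apply: eq_integral => x Dx.
  by rewrite /= /ext patchT.
- exact: measurableC.
- exact: measurableT_comp.
- by move=> x _; exact: h0.
- exact: iso_dom_full.
Qed.

Lemma finite_norm_iso_comp (f : Y -> R) : measurable_fun setT f ->
  finite_norm nu 2%:E f -> finite_norm mu 2%:E (iso_comp f).
Proof.
move=> mf; rewrite /finite_norm unlock /Lnorm.
have mh : measurable_fun [set: Y] (fun y => `|(EFin \o f) y| `^ 2)%E.
  apply: (measurableT_comp (measurable_poweR _)) => //.
  by apply: measurableT_comp => //; apply: measurableT_comp.
rewrite -(integral_iso_comp mh); last by move=> y; exact: poweR_ge0.
apply: le_lt_trans; rewrite le_eqVlt; apply/orP; left; apply/eqP.
congr (_ `^ _)%E; rewrite [RHS]integral_mkcond; apply: eq_integral => x _.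
rewrite /iso_comp /= !patchE; case: ifPn => //= _.
by rewrite normr0 powR0// pnatr_eq0.
Qed.


Section iso_koopman.
Variable f : LspaceType2 nu.

Let mf : @measurable_fun _ _ X (measurableTypeR R) [set: X] (iso_comp f).
Proof. exact: (measurable_iso_comp (measurable_Lspace f)). Qed.

Let mfun_comp : {mfun X >-> measurableTypeR R} :=
  HB.pack (iso_comp f) (isMeasurableFun.Build _ _ _ _ _ mf).

Let cls : {mfun_ mu, X >-> measurableTypeR R} :=
  \pi_({mfun_ mu, X >-> measurableTypeR R})%qT mfun_comp.

Let clsE : \forall x \ae mu, cls x = iso_comp f x.
Proof.
have /eqP := reprK cls; rewrite eqmodE => /asboolP.
by apply: filterS => x /(_ I).
Qed.

Let cls_finite : finite_norm mu 2%:E cls.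
Proof.
have mcls : measurable_fun [set: X] (cls : X -> R).
  exact: (measurable_funP (repr cls)).
have sq (h : X -> R) : measurable_fun [set: X] h ->
    measurable_fun [set: X] (fun x => `|(EFin \o h) x| `^ 2)%E.
  move=> mh; apply: (measurableT_comp (measurable_poweR _)) => //.
  by apply: measurableT_comp => //; apply: measurableT_comp.
have := finite_norm_iso_comp (measurable_Lspace f) Lebesgue_finite.
rewrite /finite_norm unlock /Lnorm; apply: le_lt_trans.
rewrite le_eqVlt; apply/orP; left; apply/eqP; congr (_ `^ _)%E.
apply: ae_eq_integral => //; [exact: sq|exact: sq|].
by apply: filterS clsE => x /= ->.
Qed.

Definition iso_koopman : LspaceType2 mu :=
  HB.pack cls (isFinLebesgue.Build _ _ _ mu 2%:E (lee1n 2) cls cls_finite).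

Lemma iso_koopmanE : \forall x \ae mu, iso_koopman x = f (Phi x).
Proof.
have domae : \forall x \ae mu, iso_dom Phi x.
  exists (~` iso_dom Phi); split => //; last exact: iso_dom_full.
  exact/measurableC/measurable_iso_dom.
apply: filterS2 clsE domae => x /= -> Dx.
by rewrite /iso_comp patchT ?inE.
Qed.

End iso_koopman.

End koopman.

Lemma Lspace_ext d (X : measurableType d) (R : realType)
    (mu : {measure set X -> \bar R}) (f g : LspaceType2 mu) :
  (\forall x \ae mu, f x = g x) -> f = g.
Proof.
move=> fg; have : LebesgueSpace.sort f = LebesgueSpace.sort g.
  rewrite -[LHS]reprK -[RHS]reprK; apply/eqmodP/asboolP.
  by apply: filterS fg => x + _.
case: f g {fg} => [f [[cf]]] [g [[cg]]] /= fg; move: cf cg; rewrite fg => cf cg.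
by rewrite (Prop_irrelevance cf cg).
Qed.

Section mod0_iso_ae.
Context d1 d2 (X : measurableType d1) (Y : measurableType d2) (R : realType).
Variables (mu : {measure set X -> \bar R}) (nu : {measure set Y -> \bar R}).
Variable Phi : mod0_iso mu nu.

Lemma ae_iso_dom : \forall x \ae mu, iso_dom Phi x.
Proof.
exists (~` iso_dom Phi); split => //; last exact: iso_dom_full.
exact/measurableC/measurable_iso_dom.
Qed.

Lemma ae_iso (P : set Y) : (\forall y \ae nu, P y) -> \forall x \ae mu, P (Phi x).
Proof.
move=> [N [mN nuN0 PN]].
have : \forall x \ae mu, ~ (iso_dom Phi `&` Phi @^-1` N) x.
  exists (iso_dom Phi `&` Phi @^-1` N); split => [||x /= /contrapT//].
  - by apply: measurable_iso_fun => //; exact: measurable_iso_dom.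
  - by rewrite iso_preserving.
apply: filterS2 ae_iso_dom => x Dx; apply: contra_notP => nP.
by split => //; exact: PN.
Qed.

End mod0_iso_ae.

Lemma iso_koopmanK d1 d2 (X : measurableType d1) (Y : measurableType d2)
    (R : realType) (mu : {measure set X -> \bar R})
    (nu : {measure set Y -> \bar R}) (Phi : mod0_iso mu nu) :
  cancel (iso_koopman Phi) (iso_koopman (iso_sym Phi)).
Proof.
move=> f; apply: Lspace_ext.
have h1 := ae_iso_dom (iso_sym Phi).
have h2 := iso_koopmanE (iso_sym Phi) (iso_koopman Phi f).
have h3 := ae_iso (iso_sym Phi) (iso_koopmanE Phi f).
by apply: filterS3 h1 h2 h3 => y Cy -> ->; rewrite /= iso_invK.
Qed.

Lemma iso_koopmanVK d1 d2 (X : measurableType d1) (Y : measurableType d2)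
    (R : realType) (mu : {measure set X -> \bar R})
    (nu : {measure set Y -> \bar R}) (Phi : mod0_iso mu nu) :
  cancel (iso_koopman (iso_sym Phi)) (iso_koopman Phi).
Proof.
move=> f; apply: Lspace_ext.
have h1 := ae_iso_dom Phi.
have h2 := iso_koopmanE Phi (iso_koopman (iso_sym Phi) f).
have h3 := ae_iso Phi (iso_koopmanE (iso_sym Phi) f).
by apply: filterS3 h1 h2 h3 => x Dx -> ->; rewrite /= iso_funK.
Qed.

Section nonlocal.
Context d (X : measurableType d) (R : realType).
Variable mu : {measure set X -> \bar R}.

Definition schur_bounds (D : set X) (J : X * X -> R) : Prop :=
  (ess_sup mu (fun x => \int[mu]_(y in D) `|J (x, y)|%:E) < +oo)%E /\
  (ess_sup mu (fun y => \int[mu]_(x in D) `|J (x, y)|%:E) < +oo)%E.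

Definition nonlocal_integrand (J : X * X -> R) (u : X -> R) (x y : X) : R :=
  J (x, y) * (u y - u x).

(* [Rintegral] returns an arbitrary value on non-integrable functions, so that
   integrability is part of the meaning of the defining expression. *)
Definition is_nonlocal (D : set X) (J : X * X -> R) (u w : LspaceType2 mu) :
    Prop :=
  \forall x \ae mu, mu.-integrable D (EFin \o nonlocal_integrand J u x) /\
    w x = \int[mu]_(y in D) nonlocal_integrand J u x y.

Lemma is_nonlocal_unique (D : set X) (J : X * X -> R) (u w1 w2 : LspaceType2 mu) :
  is_nonlocal D J u w1 -> is_nonlocal D J u w2 -> w1 = w2.
Proof.
by move=> h1 h2; apply: Lspace_ext; apply: filterS2 h1 h2 => x [_ ->] [_ ->].
Qed.

(* Operator with its natural domain: [None] outside of the domain. *)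
Definition nonlocal (D : set X) (J : X * X -> R) (u : LspaceType2 mu) :
    option (LspaceType2 mu) :=
  if pselect (exists w, is_nonlocal D J u w) is left h
  then Some (projT1 (cid h)) else None.

Lemma nonlocalP (D : set X) (J : X * X -> R) (u w : LspaceType2 mu) :
  nonlocal D J u = Some w <-> is_nonlocal D J u w.
Proof.
rewrite /nonlocal; case: pselect => [h|nh]; last first.
  by split => // hw; case: nh; exists w.
split => [[<-]|hw]; first exact: (projT2 (cid h)).
by congr Some; exact: is_nonlocal_unique (projT2 (cid h)) hw.
Qed.

(* [w] is the derivative at [t], in L^2 norm and within [I], of the L^2-valued
   function [u]. *)
Definition is_L2_derive (I : interval R) (u : R -> LspaceType2 mu) (t : R)
    (w : LspaceType2 mu) : Prop :=
  ('N[mu]_2%:E [EFin \o (fun x => (u s x - u t x) / (s - t) - w x)%R]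
    @[s --> within [set s | s \in I /\ s != t] (nbhs t)] --> 0)%E.

Definition solves (A : LspaceType2 mu -> option (LspaceType2 mu))
    (I : interval R) (u : R -> LspaceType2 mu) : Prop :=
  forall t, t \in I -> exists2 w, A (u t) = Some w & is_L2_derive I u t w.

End nonlocal.

(* [iso_fun Phi] is arbitrary outside of [iso_dom Phi], where the transported
   kernel vanishes. *)
Definition transported_kernel d1 d2 (X : measurableType d1)
    (Y : measurableType d2) (R : realType) (mu : {measure set X -> \bar R})
    (nu : {measure set Y -> \bar R}) (Phi : mod0_iso mu nu) (J : Y * Y -> R)
    (z : X * X) : R :=
  if z \in iso_dom Phi `*` iso_dom Phi then J (Phi z.1, Phi z.2) else 0.

(* Main.v *)
(* [Phi] preserves the measure and is invertible off null sets, so for a.e. [x]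
   the integrand of [L_Q (T u)] at [x] is a.e. the composite with [Phi] of the
   integrand of [L_K u] at [Phi x]. Integrability and the value of the integral
   are preserved by such a composition, hence [u] is in the domain of [L_K],
   with image [w], iff [T u] is in that of [L_Q], with image [T w]. As [T] is
   also isometric, it transports the L^2 difference quotients of [u]. *)
Require Import Defs.
From HB Require Import structures.
From mathcomp Require Import all_boot all_order all_algebra.
From mathcomp Require Import all_classical all_reals all_analysis.
From mathcomp Require Import measurable_realfun ess_sup_inf.

Set Implicit Arguments.
Unset Strict Implicit.
Unset Printing Implicit Defensive.
Import Order.TTheory GRing.Theory Num.Theory.
Import numFieldNormedType.Exports.

Local Open Scope classical_set_scope.
Local Open Scope ring_scope.

(** Makes compact sets closed, which is what gives the Borel measurability of the attractor. *)
Lemma hausdorff_rV (R : realType) (d : nat) : hausdorff_space 'rV[R]_d.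
Proof. exact: norm_hausdorff. Qed.

Section mod0_iso_integral.
Context d1 d2 (X : measurableType d1) (Y : measurableType d2) (R : realType).
Variables (mu : {measure set X -> \bar R}) (nu : {measure set Y -> \bar R}).
Variable Phi : mod0_iso mu nu.

(** The converse of [ae_iso] is [ae_iso] for the inverse isomorphism, as [Phi] undoes [iso_inv Phi]
    on [iso_cod Phi]. *)
Lemma ae_isoP (P : set Y) :
  (\forall x \ae mu, P (Phi x)) <-> (\forall y \ae nu, P y).
Proof.
split=> [h|]; last exact: ae_iso.
apply: filterS2 (ae_iso_dom (iso_sym Phi)) (ae_iso (iso_sym Phi) h).
by move=> y Cy /=; rewrite iso_invK.
Qed.

(** An integral is the difference of those of the positive and negative parts, and the nonnegative
    case applies to each. *)
Lemma integral_iso_dom (h : Y -> \bar R) : measurable_fun [set: Y] h ->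
  (\int[mu]_(x in iso_dom Phi) h (Phi x) = \int[nu]_y h y)%E.
Proof.
move=> mh; rewrite integralE [RHS]integralE; congr (_ - _)%E.
- rewrite -(integral_iso_comp Phi (h := h^\+%E))//.
    by apply: eq_integral => x _; rewrite !funeposE.
  exact: measurable_funepos.
- rewrite -(integral_iso_comp Phi (h := h^\-%E))//.
    by apply: eq_integral => x _; rewrite !funenegE.
  exact: measurable_funeneg.
Qed.

Section full_domains.
Variables (D : set X) (E : set Y).
Hypotheses (mD : measurable D) (mE : measurable E).
Hypotheses (domD : iso_dom Phi `<=` D) (codE : iso_cod Phi `<=` E).

(** Zero extensions turn both sides into integrals over the whole spaces; since [D] and [E] contain
    the full-measure sets between which [Phi] is bijective, the extensions still match through [Phi]
    almost everywhere. *)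
Lemma integral_iso (g : X -> \bar R) (h : Y -> \bar R) :
  measurable_fun D g -> measurable_fun E h ->
  (\forall x \ae mu, g x = h (Phi x)) ->
  (\int[mu]_(x in D) g x = \int[nu]_(y in E) h y)%E.
Proof.
move=> mg mh gh.
have mhE : measurable_fun [set: Y] (h \_ E) by apply/(measurable_restrictT h mE).
have mdom := measurable_iso_dom Phi.
rewrite integral_mkcond [RHS]integral_mkcond -integral_iso_dom//.
rewrite [RHS]integral_mkcond; apply: ae_eq_integral => //.
- exact/(measurable_restrictT g mD).
- apply/(measurable_restrictT _ mdom).
  by apply: (measurable_comp measurableT) => //; exact: measurable_iso_fun.
- apply: filterS2 gh (ae_iso_dom Phi) => x gx Dx _.
  rewrite !patchT ?inE//; [exact/codE/iso_funS|exact: domD].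
Qed.

Lemma integrable_iso (g : X -> \bar R) (h : Y -> \bar R) :
  measurable_fun D g -> measurable_fun E h ->
  (\forall x \ae mu, g x = h (Phi x)) ->
  mu.-integrable D g <-> nu.-integrable E h.
Proof.
move=> mg mh gh.
have gh_abs : (\int[mu]_(x in D) `|g x| = \int[nu]_(y in E) `|h y|)%E.
  apply: integral_iso; [exact: measurableT_comp|exact: measurableT_comp|].
  by apply: filterS gh => x ->.
split=> /integrableP[_ fin]; apply/integrableP; split=> //.
- by rewrite -gh_abs.
- by rewrite gh_abs.
Qed.

End full_domains.

(** [integral_iso] for the squares, over the whole spaces; this is the isometry of [T]. *)
Lemma Lnorm_iso (g : X -> R) (h : Y -> R) :
  measurable_fun [set: X] g -> measurable_fun [set: Y] h ->
  (\forall x \ae mu, g x = h (Phi x)) ->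
  ('N[mu]_2%:E [EFin \o g] = 'N[nu]_2%:E [EFin \o h])%E.
Proof.
move=> mg mh gh; rewrite unlock /Lnorm; congr (_ `^ _)%E.
apply: integral_iso => //; last by apply: filterS gh => x /= ->.
- apply: (measurableT_comp (measurable_poweR _)) => //.
  by apply: measurableT_comp => //; apply: measurableT_comp.
- apply: (measurableT_comp (measurable_poweR _)) => //.
  by apply: measurableT_comp => //; apply: measurableT_comp.
Qed.

Section nonlocal_iso.
Variables (D : set X) (E : set Y).
Hypotheses (mD : measurable D) (mE : measurable E).
Hypotheses (domD : iso_dom Phi `<=` D) (codE : iso_cod Phi `<=` E).
Variable J : Y * Y -> R.
Hypothesis mJ : measurable_fun (E `*` E) J.

(** [J] is controlled only on the square of [E]; its zero extension is measurable on the whole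
    product, hence so are the sections of that extension. *)
Lemma measurable_kernel_section (y : Y) : E y ->
  measurable_fun [set: Y] ((fun y' => J (y, y')) \_ E).
Proof.
move=> Ey; have mEE : measurable (E `*` E) by exact: measurableX.
have mJE : measurable_fun [set: Y * Y] (J \_ (E `*` E)).
  exact/(measurable_restrictT J mEE).
rewrite (_ : _ \_ E = (J \_ (E `*` E)) \o pair y).
  exact: measurableT_comp.
apply/funext => y' /=; rewrite !patchE in_setX /=.
by rewrite (mem_set Ey).
Qed.

Lemma measurable_transported_section (x : X) : iso_dom Phi x ->
  measurable_fun [set: X] (fun x' => transported_kernel Phi J (x, x')).
Proof.
move=> Dx.
(* Both sides vanish off [iso_dom Phi]; on it the cut-off to [E] has no effect, because [Phi] takes
   values in [iso_cod Phi], inside [E]. *)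
rewrite (_ : (fun _ => _) = iso_comp Phi ((fun y' => J (Phi x, y')) \_ E)).
  exact/measurable_iso_comp/measurable_kernel_section/codE/iso_funS.
apply/funext => x'; rewrite /transported_kernel /iso_comp patchE in_setX/=.
rewrite (mem_set Dx)/=; case: ifPn => // /set_mem Dx'.
by rewrite patchT// inE; exact/codE/iso_funS.
Qed.

Lemma is_nonlocal_iso (u w : LspaceType2 nu) :
  is_nonlocal D (transported_kernel Phi J) (iso_koopman Phi u)
    (iso_koopman Phi w) <-> is_nonlocal E J u w.
Proof.
(* The condition for a.e. [y] is pulled back to the points [Phi x], so that two a.e. conditions on
   [X] can be compared pointwise. *)
rewrite /is_nonlocal -ae_isoP.
have Tu := iso_koopmanE Phi u; have Tw := iso_koopmanE Phi w.
have eqv : \forall x \ae mu,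
    (mu.-integrable D (EFin \o nonlocal_integrand (transported_kernel Phi J)
       (iso_koopman Phi u) x) /\
     iso_koopman Phi w x = \int[mu]_(x' in D)
       nonlocal_integrand (transported_kernel Phi J) (iso_koopman Phi u) x x')
    <->
    (nu.-integrable E (EFin \o nonlocal_integrand J u (Phi x)) /\
     w (Phi x) = \int[nu]_(y in E) nonlocal_integrand J u (Phi x) y).
  apply: filterS3 (ae_iso_dom Phi) (Tu) Tw => x Dx Tux Twx.
  set g := EFin \o _; set h := EFin \o nonlocal_integrand J u (Phi x).
  have mg : measurable_fun D g.
    apply: measurableT_comp => //; apply: measurable_funTS.
    apply: measurable_funM; first exact: measurable_transported_section.
    by apply: measurable_funB => //; exact: measurable_Lspace.
  have mh : measurable_fun E h.
    apply: measurableT_comp => //; apply: measurable_funM.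
      apply/(measurable_restrictT _ mE).
      exact/measurable_kernel_section/codE/iso_funS.
    apply: measurable_funTS.
    by apply: measurable_funB => //; exact: measurable_Lspace.
  (* With [x] fixed outside a null set, [Tu] serves a second time, now for almost every integration
     variable [x']. *)
  have gh : \forall x' \ae mu, g x' = h (Phi x').
    apply: filterS2 (ae_iso_dom Phi) Tu => x' Dx' Tux'.
    rewrite /g /h /= /nonlocal_integrand Tux Tux' /transported_kernel.
    by rewrite in_setX /= !mem_set.
  rewrite Twx /Rintegral (integral_iso mD mE domD codE mg mh gh).
  by rewrite (integrable_iso mD mE domD codE mg mh gh).
by split=> h; apply: filterS2 eqv h => x -> .
Qed.

Lemma is_L2_derive_iso (I : interval R) (u : R -> LspaceType2 nu) (t : R)
    (w : LspaceType2 nu) :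
  is_L2_derive I (iso_koopman Phi \o u) t (iso_koopman Phi w) <->
  is_L2_derive I u t w.
Proof.
rewrite /is_L2_derive; set F := fun s : R => _; set G := fun s : R => _.
(* The norms agree for each [s] separately, so the exceptional null set may depend on [s]. *)
suff -> : F = G by [].
apply/funext => s; apply: Lnorm_iso.
- apply: measurable_funB; last exact: measurable_Lspace.
  apply: measurable_funM => //.
  by apply: measurable_funB; exact: measurable_Lspace.
- apply: measurable_funB; last exact: measurable_Lspace.
  apply: measurable_funM => //.
  by apply: measurable_funB; exact: measurable_Lspace.
apply: filterS3 (iso_koopmanE Phi (u s)) (iso_koopmanE Phi (u t))
  (iso_koopmanE Phi w) => x us ut wx.
by rewrite /= us ut wx.
Qed.

Lemma nonlocal_iso (v : LspaceType2 nu) :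
  nonlocal D (transported_kernel Phi J) (iso_koopman Phi v) =
  omap (iso_koopman Phi) (nonlocal E J v).
Proof.
case Lv : (nonlocal E J v) => [w|] /=.
  by apply/nonlocalP/is_nonlocal_iso/nonlocalP.
case LTv : (nonlocal _ _ _) => [w|] //; exfalso.
(* As [T] is onto, [w] is [T] of some element, which would be the value of the operator at [v]; [Lv]
   excludes this. *)
move: LTv; rewrite -(iso_koopmanVK Phi w) => /nonlocalP/is_nonlocal_iso.
by move=> /nonlocalP; rewrite Lv.
Qed.

Lemma solves_iso (I : interval R) (u : R -> LspaceType2 nu) :
  solves (nonlocal (mu := nu) E J) I u <->
  solves (nonlocal (mu := mu) D (transported_kernel Phi J)) I
    (iso_koopman Phi \o u).
Proof.
split=> sol t /sol[w Aw dw].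
  exists (iso_koopman Phi w); last exact/is_L2_derive_iso.
  by rewrite /= nonlocal_iso Aw.
(* [omap] yields [Some] only if [u t] lies in the domain on [Y]; the given derivative is then
   [T w'], and [w'] is the one sought. *)
move: Aw; rewrite /= nonlocal_iso.
case Lu : (nonlocal E J (u t)) => [w'|] //= [ww'].
by exists w' => //; apply/is_L2_derive_iso; rewrite ww'.
Qed.

End nonlocal_iso.
End mod0_iso_integral.

Theorem proposition7p1 (R : realType) (d k : nat) (k1 : (1 < k)%N)
    (f : 'I_k -> 'rV[R]_d -> 'rV[R]_d) (r : 'I_k -> R)
    (hf : forall i, is_similitude (r i) (f i))
    (K : set (borel_rV R d)) (hK : is_attractor f K)
    (mu : probability (symbolic k1) R) (hmu : is_uniform_bernoulli mu)
    (nu : probability (borel_rV R d) R)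
    (hnu : forall A : set (borel_rV R d), measurable A ->
      nu A = mu (natural_projection f K @^-1` A))
    (hinj : mu.-negligible
      [set w | exists2 w', w' <> w &
        natural_projection f K w' = natural_projection f K w])
    (Phi : mod0_iso (lebesgue01 R) nu)
    (hQ0 : iso_dom Phi `<=` Qint R) (hK0 : iso_cod Phi `<=` K)
    (hPhi : \forall w \ae mu,
      Phi (natural_projection (@interval_map R k) (Qint R) w) =
      natural_projection f K w)
    (J : borel_rV R d * borel_rV R d -> R)
    (mJ : measurable_fun (K `*` K) J)
    (hJ : (J \_ (K `*` K)) \in Lfun (nu \x nu)%E 2%:E \/ schur_bounds nu K J) :
  let T := iso_koopman Phi in
  let Tinv := iso_koopman (iso_sym Phi) in
  let LK := nonlocal (mu := nu) K J in
  let LQ := nonlocal (mu := lebesgue01 R) (Qint R) (transported_kernel Phi J) in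
  omap T \o LK \o Tinv = LQ /\
  (forall (I : interval R) (u : R -> LspaceType2 nu),
    solves LK I u <-> solves LQ I (T \o u)).
Proof.
(* The complement of [K] is open, hence a generator of the Borel sigma-algebra. *)
have mK : measurable K.
  rewrite -[K]setCK; apply: measurableC; apply: sub_sigma_algebra.
  apply: closed_openC; case: hK => _ cK _.
  exact: compact_closed (@hausdorff_rV R d) cK.
have mQ := @measurable_Qint R.
split=> [|I u]; last exact: solves_iso.
apply/funext => v /=.
(* The intertwining relation is taken at [Tinv v], where [T (Tinv v) = v]. *)
by rewrite -(nonlocal_iso mQ mK hQ0 hK0 mJ) iso_koopmanVK.
Qed.
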